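(* Let $n$ be a positive integer, let $v_1,\dots,v_n$ be real numbers with $\sum_{i=1}^n v_i^2\le 1$, and let $S:=\sum_{i=1}^n v_i\epsilon_i$. Then $$P(|S|\le 1)\ \ge\ G\!\left(\tfrac14\right)=\frac12-\frac{1-\Phi(2)}{4\,(1-\Phi(\sqrt2))}=\frac12-\frac{\Phi(-2)}{4\,\Phi(-\sqrt2)}\approx 0.42768 .$$
   Context: $\epsilon_1,\dots,\epsilon_n$ are independent Rademacher random variables, i.e. each takes the values $+1$ and $-1$ with probability $\tfrac12$. $\Phi$ denotes the standard normal distribution function. For $c>0$, $G(c):=\frac12\left(1-\frac12\,\frac{1-\Phi(c^{-1/2})}{1-\Phi(\sqrt2)}\right)$. *)

(* Defs.v *)
From Stdlib Require Import Reals Lra List.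
Import ListNotations.
Open Scope R_scope.

Definition gauss (t : R) : R := exp (- (t ^ 2) / 2).

Lemma gauss_cont : continuity gauss.
Proof.
  unfold gauss. apply derivable_continuous. reg.
Qed.

Lemma gauss_int (a b : R) : Riemann_integrable gauss a b.
Proof.
  destruct (Rle_dec a b) as [H|H].
  - apply continuity_implies_RiemannInt; auto. intros; apply gauss_cont.
  - apply RiemannInt_P1. apply continuity_implies_RiemannInt; [lra|].
    intros; apply gauss_cont.
Qed.

(* Standard normal distribution function:
   Phi x = 1/2 + (1/sqrt(2 pi)) * int_0^x exp(-t^2/2) dt
   (uses int_{-oo}^0 of the density = 1/2; the value of RiemannInt does
   not depend on the integrability proof, by RiemannInt_P5). *)
Definition Phi (x : R) : R := / 2 + / sqrt (2 * PI) * RiemannInt (gauss_int 0 x).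

Definition G (c : R) : R :=
  / 2 * (1 - / 2 * ((1 - Phi (/ sqrt c)) / (1 - Phi (sqrt 2)))).

Fixpoint all_signs (n : nat) : list (list R) :=
  match n with
  | O => [ [] ]
  | S m => flat_map (fun l => [1 :: l; -1 :: l]) (all_signs m)
  end.

Definition rad_sum (v eps : list R) : R :=
  fold_right Rplus 0 (map (fun p => fst p * snd p) (combine v eps)).

Definition sum_sq (v : list R) : R := fold_right Rplus 0 (map (fun x => x ^ 2) v).

(* P(|S| <= 1) for independent Rademacher eps_i (uniform on {+1,-1}^n). *)
Definition prob_abs_S_le_1 (v : list R) : R :=
  INR (length (filter (fun eps => if Rle_dec (Rabs (rad_sum v eps)) 1 then true else false)
                      (all_signs (length v))))
  / 2 ^ (length v).

(* Main.v *)
(* Both steps prove the bound 0.43, slightly above G(1/4) = 0.42768.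

   Assume v_1 >= v_2 >= ... >= 0. If v_3 + v_4 + v_5 <= 1, add the signed terms in the
   order v_3, v_4, ..., and finally v_1, v_2, stopping at the first position x for which
   the next term w satisfies |x| + w > 1. By symmetry of the remaining sum Y,
   P(|x + Y| <= 1) >= P(|Y| <= 1 + |x|) / 2, and the fourth moment of Y bounds this from
   below. With s the variance already spent, s - x^2 is a martingale, so it suffices
   that the bound at each stopping position is at least 0.43 + (s - x^2) / 10. With
   d = 1 - |x| < w this follows from s >= d + d^2 if the path has changed direction, and
   from s >= d - d^2, d <= 1/4 if it has not (then at least three steps were made).

   If v_3 + v_4 + v_5 > 1, let A be the sum of all other terms, so that
   E A^2 <= 1 - v_3^2 - v_4^2 - v_5^2. The probability given A is at least a decreasing
   affine function of A^2, whose expectation is at least 0.43. *)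

Require Import Defs.
From Coquelicot Require Import Coquelicot.
From Stdlib Require Import Reals List Lra Lia Psatz Permutation Sorted Machin.
Import ListNotations.
Open Scope R_scope.

(** * Expectation over independent signs *)

(** Expectation of [f] at a Rademacher sum, taken one sign at a time: conditioning on the next step
    of a walk is then mere unfolding, which the counting form of [prob_abs_S_le_1] does not
    offer. *)
Fixpoint mean (l : list R) (f : R -> R) : R :=
  match l with
  | [] => f 0
  | x :: l' => (mean l' (fun y => f (x + y)) + mean l' (fun y => f (- x + y))) / 2
  end.

Lemma mean_le l f g : (forall y, f y <= g y) -> mean l f <= mean l g.
Proof.
  revert f g; induction l as [|x l IH]; intros f g H; simpl; auto.
  pose proof (IH (fun y => f (x + y)) (fun y => g (x + y)) (fun y => H _)).
  pose proof (IH (fun y => f (- x + y)) (fun y => g (- x + y)) (fun y => H _)).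
  lra.
Qed.

Lemma mean_ext l f g : (forall y, f y = g y) -> mean l f = mean l g.
Proof.
  intros H; apply Rle_antisym; apply mean_le; intros y; rewrite H; lra.
Qed.

Lemma mean_lin l a b f g :
  mean l (fun y => a * f y + b * g y) = a * mean l f + b * mean l g.
Proof.
  revert f g; induction l as [|x l IH]; intros f g; simpl; [lra|].
  rewrite (IH (fun y => f (x + y)) (fun y => g (x + y))).
  rewrite (IH (fun y => f (- x + y)) (fun y => g (- x + y))). lra.
Qed.

Lemma mean_const l c : mean l (fun _ => c) = c.
Proof. induction l as [|x l IH]; simpl; [|rewrite IH]; lra. Qed.

Lemma mean_opp l f : mean l (fun y => f (- y)) = mean l f.
Proof.
  revert f; induction l as [|x l IH]; intros f; simpl.
  - f_equal; lra.
  - rewrite <- (IH (fun y => f (x + y))), <- (IH (fun y => f (- x + y))).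
    rewrite (mean_ext l (fun y => f (- (x + y))) (fun y => f (- x + - y)))
      by (intros; f_equal; lra).
    rewrite (mean_ext l (fun y => f (- (- x + y))) (fun y => f (x + - y)))
      by (intros; f_equal; lra).
    lra.
Qed.

Lemma mean_perm l l' : Permutation l l' -> forall f, mean l f = mean l' f.
Proof.
  induction 1 as [|x l l' _ IH|x y l|l l' l'' _ IH1 _ IH2]; intros f; simpl; auto.
  - rewrite !IH; auto.
  - assert (H : forall a b, mean l (fun z => f (a + (b + z))) = mean l (fun z => f (b + (a + z))))
      by (intros; apply mean_ext; intros; f_equal; lra).
    rewrite (H y x), (H y (- x)), (H (- y) x), (H (- y) (- x)). lra.
  - rewrite IH1; auto.
Qed.

Lemma mean_app l l' f : mean l (fun x => mean l' (fun y => f (x + y))) = mean (l ++ l') f.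
Proof.
  revert f; induction l as [|x l IH]; intros f; simpl.
  - apply mean_ext; intros; f_equal; lra.
  - rewrite <- !IH. f_equal. f_equal; apply mean_ext; intros; apply mean_ext;
      intros; f_equal; lra.
Qed.

Lemma mean_abs l f : mean (map Rabs l) f = mean l f.
Proof.
  revert f; induction l as [|x l IH]; intros f; simpl; auto.
  rewrite !IH. unfold Rabs; destruct (Rcase_abs x); auto.
  rewrite Ropp_involutive; lra.
Qed.

(** * Second and fourth moments *)

Lemma sum_sq_cons x l : sum_sq (x :: l) = x ^ 2 + sum_sq l.
Proof. reflexivity. Qed.

Lemma sum_sq_nonneg l : 0 <= sum_sq l.
Proof.
  induction l as [|x l IH]; [unfold sum_sq; simpl; lra|rewrite sum_sq_cons].
  pose proof (pow2_ge_0 x); lra.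
Qed.

Lemma sum_sq_perm l l' : Permutation l l' -> sum_sq l = sum_sq l'.
Proof.
  induction 1 as [|x l l' _ IH|x y l|l l' l'' _ IH1 _ IH2]; rewrite ?sum_sq_cons; lra.
Qed.

Lemma sum_sq_abs l : sum_sq (map Rabs l) = sum_sq l.
Proof.
  induction l as [|x l IH]; simpl map; rewrite ?sum_sq_cons, ?pow2_abs; lra.
Qed.

Lemma mean_sq l : mean l (fun y => y ^ 2) = sum_sq l.
Proof.
  induction l as [|x l IH]; [unfold sum_sq; simpl; lra|].
  rewrite sum_sq_cons, <- IH; cbn [mean].
  pose proof (mean_lin l (/ 2) (/ 2) (fun y => (x + y) ^ 2) (fun y => (- x + y) ^ 2)) as H.
  rewrite (mean_ext l _ (fun y => x ^ 2 * 1 + 1 * y ^ 2)) in H by (intros; lra).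
  rewrite mean_lin, mean_const in H. lra.
Qed.

(** Odd cross terms cancel over the sign of [x], leaving E Y^4 + 6 x^2 E Y^2 + x^4; only the last
    term is below its counterpart 3 x^4 in the expanded square. *)
Lemma mean_fourth l : mean l (fun y => y ^ 4) <= 3 * sum_sq l ^ 2.
Proof.
  induction l as [|x l IH]; [unfold sum_sq; simpl; lra|].
  rewrite sum_sq_cons; cbn [mean].
  pose proof (mean_lin l (/ 2) (/ 2) (fun y => (x + y) ^ 4) (fun y => (- x + y) ^ 4)) as H.
  rewrite (mean_ext l _ (fun y => 1 * y ^ 4 + 1 * (6 * x ^ 2 * y ^ 2 + x ^ 4 * 1))) in H
    by (intros; field).
  rewrite mean_lin, mean_lin, mean_const, mean_sq in H.
  pose proof (pow2_ge_0 (x ^ 2)). unfold Rdiv; nra.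
Qed.

(** * The indicator of [-1, 1] and its expectation *)

Definition good (y : R) : R := if Rle_dec (Rabs y) 1 then 1 else 0.

Lemma good_in y : -1 <= y <= 1 -> good y = 1.
Proof.
  intros H; unfold good; destruct (Rle_dec (Rabs y) 1) as [|n]; auto.
  destruct n; apply Rabs_le; lra.
Qed.

Lemma good_bounds y : 0 <= good y <= 1.
Proof. unfold good; destruct (Rle_dec (Rabs y) 1); lra. Qed.

Lemma good_opp y : good (- y) = good y.
Proof. unfold good; rewrite Rabs_Ropp; auto. Qed.

Lemma prob_mean v : prob_abs_S_le_1 v = mean v good.
Proof.
  unfold prob_abs_S_le_1.
  (* The offset [x] carries the signs already fixed, so that the induction on [v] goes through. *)
  assert (H : forall v x, INR (length (filter (fun eps =>
      if Rle_dec (Rabs (x + rad_sum v eps)) 1 then true else false)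
      (all_signs (length v)))) = 2 ^ length v * mean v (fun y => good (x + y))).
  { clear v; induction v as [|w v IH]; intros x.
    - simpl. unfold rad_sum, good; simpl.
      destruct (Rle_dec (Rabs (x + 0)) 1); simpl; lra.
    - simpl.
      rewrite (mean_ext v (fun y => good (x + (w + y))) (fun y => good (x + w + y)))
        by (intros; f_equal; lra).
      rewrite (mean_ext v (fun y => good (x + (- w + y))) (fun y => good (x - w + y)))
        by (intros; f_equal; lra).
      transitivity (2 ^ length v * mean v (fun y => good (x + w + y)) +
                    2 ^ length v * mean v (fun y => good (x - w + y))); [|field].
      rewrite <- !IH; clear IH.
      induction (all_signs (length v)) as [|eps L IH]; [simpl; lra|].
      assert (H1 : x + rad_sum (w :: v) (1 :: eps) = x + w + rad_sum v eps)
        by (unfold rad_sum; simpl; lra).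
      assert (H2 : x + rad_sum (w :: v) (-1 :: eps) = x - w + rad_sum v eps)
        by (unfold rad_sum; simpl; lra).
      simpl. rewrite H1, H2.
      destruct (Rle_dec (Rabs (x + w + rad_sum v eps)) 1);
      destruct (Rle_dec (Rabs (x - w + rad_sum v eps)) 1);
      cbn [length]; rewrite ?S_INR, IH; lra. }
  assert (Hp : 2 ^ length v <> 0) by (apply pow_nonzero; lra).
  replace (mean v good) with (2 ^ length v * mean v (fun y => good (0 + y)) / 2 ^ length v).
  - rewrite <- H. f_equal. f_equal. f_equal. apply filter_ext. intros eps.
    now rewrite Rplus_0_l.
  - rewrite (mean_ext v (fun y => good (0 + y)) good) by (intros; f_equal; lra).
    field; auto.
Qed.

(* One of [x + y] and [x - y] lies in [-1, 1] as soon as [|y| <= 1 + |x|]. *)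
Lemma mean_good_fourth l x : Rabs x <= 1 ->
  (1 - 3 * sum_sq l ^ 2 / (1 + Rabs x) ^ 4) / 2 <= mean l (fun y => good (x + y)).
Proof.
  intros Hx.
  pose proof (Rabs_pos x) as Hx0.
  assert (Hp : 0 < (1 + Rabs x) ^ 4) by (apply pow_lt; lra).
  pose proof (mean_opp l (fun y => good (x + y))) as Hs.
  pose proof (mean_lin l 1 1 (fun y => good (x + y)) (fun y => good (x + - y))) as Ha.
  (* Markov's inequality in pointwise form, after pairing [y] with [- y]: the left side is at most 1
     always, and at most 0 once |y| > 1 + |x|. *)
  assert (Hb : mean l (fun y => 1 * 1 + (- / (1 + Rabs x) ^ 4) * y ^ 4) <=
               mean l (fun y => 1 * good (x + y) + 1 * good (x + - y))).
  { apply mean_le; intros y.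
    pose proof (good_bounds (x + y)). pose proof (good_bounds (x + - y)).
    destruct (Rle_dec (Rabs y) (1 + Rabs x)) as [Hy|Hy].
    - assert (0 <= / (1 + Rabs x) ^ 4 * y ^ 4).
      { apply Rmult_le_pos; [left; apply Rinv_0_lt_compat; auto|].
        replace (y ^ 4) with ((y ^ 2) ^ 2) by ring. apply pow2_ge_0. }
      enough (good (x + y) = 1 \/ good (x + - y) = 1) by lra.
      revert Hx Hy; unfold Rabs.
      destruct (Rcase_abs x), (Rcase_abs y); intros;
        ((left; apply good_in; lra) || (right; apply good_in; lra)).
    - assert (1 <= / (1 + Rabs x) ^ 4 * y ^ 4); [|lra].
      apply Rmult_le_reg_l with ((1 + Rabs x) ^ 4); auto.
      rewrite <- Rmult_assoc, Rinv_r, Rmult_1_l, Rmult_1_r by lra.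
      replace (y ^ 4) with (Rabs y ^ 4).
      + apply pow_incr; lra.
      + replace (Rabs y ^ 4) with ((Rabs y ^ 2) ^ 2) by ring.
        rewrite pow2_abs; ring. }
  rewrite mean_lin, mean_const in Hb.
  rewrite Ha in Hb. rewrite Hs in Hb.
  pose proof (mean_fourth l) as Hf.
  assert (/ (1 + Rabs x) ^ 4 * mean l (fun y => y ^ 4) <=
          / (1 + Rabs x) ^ 4 * (3 * sum_sq l ^ 2)).
  { apply Rmult_le_compat_l; auto. left; apply Rinv_0_lt_compat; auto. }
  unfold Rdiv; lra.
Qed.

(** * Bounds at the stopping positions *)

(** Convexity in [S]: the chord bounds S^2, and what remains is affine in [S]. *)
Lemma quadratic_le_of_ends a b L U S : L <= S <= U ->
  3 / 2 * (1 - L) ^ 2 <= a - b * L -> 3 / 2 * (1 - U) ^ 2 <= a - b * U ->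
  3 / 2 * (1 - S) ^ 2 <= a - b * S.
Proof.
  intros HS HL HU.
  assert (H : 0 <= (S - L) * (U - S)) by nra.
  enough (3 / 2 * (1 - L * U) - a + (3 / 2 * (L + U - 2) + b) * S <= 0) by nra.
  destruct (Rle_dec 0 (3 / 2 * (L + U - 2) + b)); nra.
Qed.

(** The stopping inequality at S = 1 - d^2, the most variance that can be spent when a term larger
    than [d] is still to come. *)
Lemma upper_end_ineq d : 0 <= d <= / 2 ->
  3 / 2 * d ^ 4 <= (2 - d) ^ 4 * (7 / 100 - 2 / 10 * (d - d ^ 2)).
Proof.
  intros H.
  assert (5 <= (2 - d) ^ 4).
  { replace ((2 - d) ^ 4) with (((2 - d) ^ 2) ^ 2) by ring.
    assert (9 / 4 <= (2 - d) ^ 2) by nra. nra. }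
  assert (d ^ 4 <= / 16).
  { replace (d ^ 4) with ((d ^ 2) ^ 2) by ring. assert (d ^ 2 <= / 4) by nra. nra. }
  assert (2 / 100 <= 7 / 100 - 2 / 10 * (d - d ^ 2)) by nra. nra.
Qed.

Lemma bent_end_ineq d : 0 <= d <= / 2 ->
  3 / 2 * (1 - (d + d ^ 2)) ^ 2 <= (2 - d) ^ 4 * (17 / 100 - 3 / 10 * d).
Proof.
  (* The inequality is nearly tight at d = 1/2 (0.094 against 0.101), hence the expansion around
     that end. *)
  intros H. set (e := / 2 - d). replace d with (/ 2 - e) by (unfold e; lra).
  assert (0 <= e <= / 2) by (unfold e; lra). clearbody e. clear H d. nra.
Qed.

Lemma straight_end_ineq d : 0 <= d <= / 4 ->
  3 / 2 * (1 - (d - d ^ 2)) ^ 2 <=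
  (2 - d) ^ 4 * (17 / 100 - 3 / 10 * d + 2 / 10 * d ^ 2).
Proof.
  (* Nearly tight at d = 1/4 (0.990 against 1.008). *)
  intros H. set (e := / 4 - d). replace d with (/ 4 - e) by (unfold e; lra).
  assert (0 <= e <= / 4) by (unfold e; lra). clearbody e. clear H d. nra.
Qed.

(** The hypothesis of [mean_good_stop] with |x| = 1 - d; 7/100 is 1/2 - 43/100. By convexity only
    the two ends of the range of [S] matter. *)
Lemma bent_stop_ineq d S : 0 <= d -> d + d ^ 2 <= S <= 1 - d ^ 2 ->
  3 / 2 * (1 - S) ^ 2 <= (2 - d) ^ 4 * (7 / 100 + / 10 * ((1 - d) ^ 2 - S)).
Proof.
  intros Hd HS. assert (Hd2 : 0 <= d <= / 2) by nra.
  pose proof (bent_end_ineq d Hd2). pose proof (upper_end_ineq d Hd2).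
  pose proof (quadratic_le_of_ends ((2 - d) ^ 4 * (7 / 100 + / 10 * (1 - d) ^ 2))
    ((2 - d) ^ 4 * / 10) _ _ _ HS). lra.
Qed.

Lemma straight_stop_ineq d S : 0 <= d <= / 4 -> d - d ^ 2 <= S <= 1 - d ^ 2 ->
  3 / 2 * (1 - S) ^ 2 <= (2 - d) ^ 4 * (7 / 100 + / 10 * ((1 - d) ^ 2 - S)).
Proof.
  intros Hd HS. assert (Hd2 : 0 <= d <= / 2) by lra.
  pose proof (straight_end_ineq d Hd). pose proof (upper_end_ineq d Hd2).
  pose proof (quadratic_le_of_ends ((2 - d) ^ 4 * (7 / 100 + / 10 * (1 - d) ^ 2))
    ((2 - d) ^ 4 * / 10) _ _ _ HS). lra.
Qed.

(* [S] is the variance already spent at position [x], and [S - x ^ 2] is a martingale. *)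
Lemma mean_good_stop l x S :
  Rabs x <= 1 -> 0 <= S -> S + sum_sq l <= 1 ->
  3 / 2 * (1 - S) ^ 2 <= (1 + Rabs x) ^ 4 * (7 / 100 + / 10 * (x ^ 2 - S)) ->
  43 / 100 + / 10 * (S - x ^ 2) <= mean l (fun y => good (x + y)).
Proof.
  intros Hx HS Hl Hi.
  eapply Rle_trans; [|apply mean_good_fourth; auto].
  pose proof (sum_sq_nonneg l). pose proof (Rabs_pos x).
  assert (Hp : 0 < (1 + Rabs x) ^ 4) by (apply pow_lt; lra).
  assert (3 / 2 * sum_sq l ^ 2 <= 3 / 2 * (1 - S) ^ 2) by nra.
  assert (3 / 2 * sum_sq l ^ 2 / (1 + Rabs x) ^ 4 <= 7 / 100 + / 10 * (x ^ 2 - S)).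
  { apply Rmult_le_reg_r with ((1 + Rabs x) ^ 4); auto.
    unfold Rdiv; rewrite Rmult_assoc, Rinv_l by lra. unfold Rdiv in *; lra. }
  unfold Rdiv in *; lra.
Qed.

(** * The stopped walk *)

Lemma sum_sq_app l l' : sum_sq (l ++ l') = sum_sq l + sum_sq l'.
Proof.
  induction l as [|x l IH]; simpl app; rewrite ?sum_sq_cons, ?IH;
    [unfold sum_sq at 2; simpl|]; lra.
Qed.

Lemma mean_good_cons x w l :
  mean (w :: l) (fun y => good (x + y)) =
  (mean l (fun y => good (x + w + y)) + mean l (fun y => good (x - w + y))) / 2.
Proof.
  cbn [mean].
  rewrite (mean_ext l (fun y => good (x + (w + y))) (fun y => good (x + w + y)))
    by (intros; f_equal; lra).
  rewrite (mean_ext l (fun y => good (x + (- w + y))) (fun y => good (x - w + y)))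
    by (intros; f_equal; lra).
  reflexivity.
Qed.

Lemma mean_good_opp l x :
  mean l (fun y => good (- x + y)) = mean l (fun y => good (x + y)).
Proof.
  rewrite <- (mean_opp l (fun y => good (x + y))). apply mean_ext; intros y.
  rewrite <- good_opp; f_equal; lra.
Qed.

(** Take x >= 0. If x + a + b <= 1, all four end points are good. Otherwise at least two are, and
    x^2 + a^2 + b^2 >= 1/3 by Cauchy-Schwarz, so S - x^2 <= 2/3 and 0.43 + 0.067 is below 1/2. *)
Lemma two_big_steps x S a b : 0 <= b <= a -> Rabs x <= 1 -> 0 <= S -> S + a ^ 2 + b ^ 2 <= 1 ->
  43 / 100 + / 10 * (S - x ^ 2) <= mean [a; b] (fun y => good (x + y)).
Proof.
  intros Hab Hx HS0 HS.
  assert (H : forall x, 0 <= x <= 1 ->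
    43 / 100 + / 10 * (S - x ^ 2) <= mean [a; b] (fun y => good (x + y))).
  { clear x Hx; intros x Hx.
    rewrite !mean_good_cons; cbn [mean]; rewrite !Rplus_0_r.
    assert (Ha : a <= 1) by nra.
    pose proof (good_bounds (x + a + b)). pose proof (good_bounds (x + a - b)).
    pose proof (good_bounds (x - a + b)). pose proof (good_bounds (x - a - b)).
    destruct (Rle_dec (x + a + b) 1) as [Hin|Hout].
    - rewrite !good_in by lra. nra.
    - assert (Hq : / 3 <= x ^ 2 + a ^ 2 + b ^ 2).
      { pose proof (pow2_ge_0 (x - a)). pose proof (pow2_ge_0 (x - b)).
        pose proof (pow2_ge_0 (b - a)). nra. }
      destruct (Rle_dec (a + b) (1 + x)) as [Hc|Hc].
      + rewrite (good_in (x - a + b)), (good_in (x - a - b)) by lra. lra.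
      + rewrite (good_in (x - a + b)), (good_in (x + a - b)) by lra. lra. }
  destruct (Rle_dec 0 x) as [H0|H0].
  - apply H. rewrite Rabs_pos_eq in Hx; lra.
  - rewrite <- mean_good_opp. replace (x ^ 2) with ((- x) ^ 2) by ring.
    apply H. rewrite Rabs_left in Hx; lra.
Qed.

(** Preserves the Cauchy-Schwarz invariant of the walk, a signed sum of [t] steps with total square
    [s], when one step is added. *)
Lemma cauchy_step x w s t : 0 <= x -> 0 <= w -> 0 <= s -> 0 <= t -> x ^ 2 <= t * s ->
  (x + w) ^ 2 <= (t + 1) * (s + w ^ 2).
Proof.
  intros Hx Hw Hs Ht H.
  assert (2 * x * w <= t * w ^ 2 + s); [|lra].
  apply Rsqr_incr_0; unfold Rsqr; [|nra|nra].
  pose proof (pow2_ge_0 (t * w ^ 2 - s)).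
  assert (w ^ 2 * x ^ 2 <= w ^ 2 * (t * s))
    by (apply Rmult_le_compat_l; auto; apply pow2_ge_0).
  lra.
Qed.

Definition descending (l : list R) : Prop := StronglySorted (fun u v => v <= u) l.

(* [m] is an earlier step taken against the current direction, and [s] is the
   variance of the other [t] steps: the position with [m] undone is their signed sum. *)
Lemma walk_bent a b l : 0 <= b <= a -> descending l -> Forall (Rle 0) l ->
  forall x s t m, Rabs x <= 1 -> 0 <= t -> 0 <= m -> 0 <= s ->
  (forall w, In w l -> w <= m /\ t * w ^ 2 <= s) ->
  (Rabs x + m) ^ 2 <= t * s ->
  s + m ^ 2 + sum_sq (l ++ [a; b]) <= 1 ->
  43 / 100 + / 10 * (s + m ^ 2 - x ^ 2) <= mean (l ++ [a; b]) (fun y => good (x + y)).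
Proof.
  intros Hab. induction l as [|w l IH]; intros Hl Hpos x s t m Hx Ht Hm Hs Hw Hxs Hsum.
  - simpl app in *. apply two_big_steps; auto; [nra|].
    unfold sum_sq in Hsum; simpl in Hsum. lra.
  - inversion Hl as [|? ? Hl' Hlw]; subst. inversion Hpos as [|? ? Hw0 Hpos']; subst.
    rewrite Forall_forall in Hlw.
    destruct (Hw w (or_introl eq_refl)) as [Hwm Hws].
    pose proof (Rabs_pos x) as Hx0.
    destruct (Rle_dec (Rabs x + w) 1) as [H1|H1].
    + assert (Hstep : forall z, z ^ 2 = w ^ 2 -> Rabs z = w ->
        43 / 100 + / 10 * (s + w ^ 2 + m ^ 2 - (x + z) ^ 2) <=
        mean (l ++ [a; b]) (fun y => good (x + z + y))).
      { intros z Hz Hzw. pose proof (Rabs_triang x z).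
        assert (0 <= Rabs (x + z)) by apply Rabs_pos.
        apply IH with (t := t + 1); auto; try nra.
        - intros w' Hin. specialize (Hlw w' Hin). destruct (Hw w' (or_intror Hin)).
          assert (0 <= w') by (rewrite Forall_forall in Hpos'; auto). nra.
        (* Either sign moves the position away from 0 by at most [w], so the same [m] serves both
           branches. *)
        - assert ((Rabs (x + z) + m) ^ 2 <= (Rabs x + m + w) ^ 2) by (apply pow_incr; lra).
          pose proof (cauchy_step (Rabs x + m) w s t). lra.
        - simpl app in Hsum; rewrite sum_sq_cons in Hsum; lra. }
      simpl app; rewrite mean_good_cons.
      pose proof (Hstep w eq_refl (Rabs_pos_eq w Hw0)).
      pose proof (Hstep (- w) ltac:(ring) ltac:(rewrite Rabs_Ropp; apply Rabs_pos_eq; auto)).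
      unfold Rminus in *. lra.
    + set (d := 1 - Rabs x).
      assert (Hd : 0 <= d < w) by (unfold d; lra).
      (* Stopping means |x| + w > 1, and m >= w. *)
      assert (Hts : 1 <= t * s) by nra.
      (* If s < d, then t d^2 <= t w^2 <= s < d gives t d < 1, hence t s < 1. With m >= w > d this
         yields s + m^2 >= d + d^2. *)
      assert (Hsd : d <= s).
      { destruct (Rle_dec d s) as [|n]; auto. exfalso.
        assert (t * d ^ 2 <= s) by nra. assert (t * d < 1) by nra. nra. }
      simpl app in *; rewrite sum_sq_cons in Hsum.
      pose proof (sum_sq_nonneg (l ++ [a; b])).
      apply mean_good_stop; auto; try rewrite sum_sq_cons; try nra.
      pose proof (bent_stop_ineq d (s + m ^ 2) ltac:(lra) ltac:(nra)) as Hi.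
      replace (1 + Rabs x) with (2 - d) by (unfold d; ring).
      replace (x ^ 2) with ((1 - d) ^ 2); auto.
      unfold d; replace (1 - (1 - Rabs x)) with (Rabs x) by ring. apply pow2_abs.
Qed.

(* All [t >= 3] steps so far went in the same direction. *)
Lemma walk_straight a b l : 0 <= b <= a -> descending l -> Forall (Rle 0) l ->
  forall x s t, 0 <= x <= 1 -> 3 <= t -> 0 <= s ->
  (forall w, In w l -> t * w <= x /\ t * w ^ 2 <= s) ->
  x ^ 2 <= t * s ->
  s + sum_sq (l ++ [a; b]) <= 1 ->
  43 / 100 + / 10 * (s - x ^ 2) <= mean (l ++ [a; b]) (fun y => good (x + y)).
Proof.
  intros Hab. induction l as [|w l IH]; intros Hl Hpos x s t Hx Ht Hs Hw Hxs Hsum.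
  - simpl app in *. apply two_big_steps; auto; [rewrite Rabs_pos_eq; lra|].
    unfold sum_sq in Hsum; simpl in Hsum. lra.
  - inversion Hl as [|? ? Hl' Hlw]; subst. inversion Hpos as [|? ? Hw0 Hpos']; subst.
    rewrite Forall_forall in Hlw.
    destruct (Hw w (or_introl eq_refl)) as [Hwx Hws].
    simpl app in *; rewrite sum_sq_cons in Hsum.
    pose proof (sum_sq_nonneg (l ++ [a; b])).
    destruct (Rle_dec (x + w) 1) as [H1|H1].
    + rewrite mean_good_cons.
      assert (43 / 100 + / 10 * (s + w ^ 2 - (x + w) ^ 2) <=
              mean (l ++ [a; b]) (fun y => good (x + w + y))).
      { apply IH with (t := t + 1); auto; try lra; [nra| |].
        - intros w' Hin. specialize (Hlw w' Hin). destruct (Hw w' (or_intror Hin)).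
          assert (0 <= w') by (rewrite Forall_forall in Hpos'; auto). nra.
        - apply cauchy_step; lra. }
      assert (43 / 100 + / 10 * (s + w ^ 2 - (x - w) ^ 2) <=
              mean (l ++ [a; b]) (fun y => good (x - w + y))).
      (* The first turn: [w] itself becomes [m], and undoing it restores [x], for which the
         invariant already holds. *)
      { assert (Habs : Rabs (x - w) = x - w) by (apply Rabs_pos_eq; nra).
        apply walk_bent with (t := t); auto; try lra.
        - intros w' Hin. split; [apply (Hlw w' Hin)|apply (Hw w' (or_intror Hin))].
        - rewrite Habs. replace (x - w + w) with x by ring. auto. }
      lra.
    + set (d := 1 - x).
      assert (Hd : 0 <= d < w) by (unfold d; lra).
      (* Here t >= 3 enters: x >= 3 w > 3 d and x = 1 - d. *)
      assert (Hd4 : d <= / 4) by (assert (3 * w <= t * w) by nra; unfold d in *; lra).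
      (* Since t d^2 <= s, d^2 x^2 <= d^2 t s <= s^2; and d x = d - d^2. *)
      assert (Hsd : d - d ^ 2 <= s).
      { assert (d ^ 2 <= w ^ 2) by (apply pow_incr; lra).
        assert (t * d ^ 2 <= s) by nra.
        assert ((d - d ^ 2) ^ 2 <= s ^ 2).
        { replace ((d - d ^ 2) ^ 2) with (d ^ 2 * x ^ 2) by (unfold d; ring).
          assert (d ^ 2 * x ^ 2 <= d ^ 2 * (t * s))
            by (apply Rmult_le_compat_l; auto; apply pow2_ge_0).
          nra. }
        apply Rsqr_incr_0_var; unfold Rsqr; lra. }
      assert (Rabs x = x) by (apply Rabs_pos_eq; lra).
      apply mean_good_stop; rewrite ?sum_sq_cons; try lra.
      pose proof (straight_stop_ineq d s ltac:(lra) ltac:(nra)) as Hi.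
      replace (1 + Rabs x) with (2 - d) by (unfold d; lra).
      replace (x ^ 2) with ((1 - d) ^ 2) by (unfold d; ring). auto.
Qed.

(** By symmetry the first sign is +. The start +++ is straight, ++- is bent with [m] = [w3], and +-
    is bent with [m] = [w2], [w3] being still to come. With weights 1/4, 1/4, 1/2 the corrections S
    - x^2 average to 0. *)
Lemma walk_case a b w1 w2 w3 l : 0 <= b <= a ->
  descending (w1 :: w2 :: w3 :: l) -> Forall (Rle 0) (w1 :: w2 :: w3 :: l) ->
  sum_sq (w1 :: w2 :: w3 :: l ++ [a; b]) <= 1 -> w1 + w2 + w3 <= 1 ->
  43 / 100 <= mean (w1 :: w2 :: w3 :: l ++ [a; b]) good.
Proof.
  intros Hab Hl Hpos Hsum Hw.
  inversion Hl as [|? ? Hl1 H1]; subst. inversion Hl1 as [|? ? Hl2 H2]; subst.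
  inversion Hl2 as [|? ? Hl3 H3]; subst.
  rewrite !Forall_cons_iff in *. destruct Hpos as (P1 & P2 & P3 & Hpos).
  destruct H1 as (H12 & H13 & H1). destruct H2 as (H23 & H2).
  rewrite Forall_forall in H1, H2, H3.
  assert (Hp : forall w, In w l -> 0 <= w) by (rewrite Forall_forall in Hpos; auto).
  rewrite !sum_sq_cons in Hsum.
  pose proof (pow2_ge_0 w1). pose proof (pow2_ge_0 w2).
  pose proof (pow2_ge_0 w3).
  rewrite (mean_ext _ good (fun y => good (0 + y))) by (intros; f_equal; lra).
  rewrite mean_good_cons.
  replace (0 - w1) with (- (0 + w1)) by ring. rewrite mean_good_opp.
  rewrite Rplus_0_l.
  rewrite mean_good_cons, (mean_good_cons (w1 + w2)).
  assert (43 / 100 + / 10 * (w1 ^ 2 + w2 ^ 2 + w3 ^ 2 - (w1 + w2 + w3) ^ 2) <=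
    mean (l ++ [a; b]) (fun y => good (w1 + w2 + w3 + y))).
  { apply walk_straight with (t := 3); auto; try lra.
    - intros w Hin. specialize (H1 w Hin). specialize (H2 w Hin). specialize (H3 w Hin).
      specialize (Hp w Hin). split; nra.
    - pose proof (pow2_ge_0 (w1 - w2)). pose proof (pow2_ge_0 (w1 - w3)).
      pose proof (pow2_ge_0 (w2 - w3)). nra. }
  assert (43 / 100 + / 10 * (w1 ^ 2 + w2 ^ 2 + w3 ^ 2 - (w1 + w2 - w3) ^ 2) <=
    mean (l ++ [a; b]) (fun y => good (w1 + w2 - w3 + y))).
  { assert (Rabs (w1 + w2 - w3) = w1 + w2 - w3) by (apply Rabs_pos_eq; lra).
    apply walk_bent with (t := 2); auto; try lra.
    - intros w Hin. specialize (H1 w Hin). specialize (H2 w Hin). specialize (H3 w Hin).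
      specialize (Hp w Hin). split; nra.
    - pose proof (pow2_ge_0 (w1 - w2)). nra. }
  assert (43 / 100 + / 10 * (w1 ^ 2 + w2 ^ 2 - (w1 - w2) ^ 2) <=
    mean ((w3 :: l) ++ [a; b]) (fun y => good (w1 - w2 + y))).
  { assert (Rabs (w1 - w2) = w1 - w2) by (apply Rabs_pos_eq; lra).
    apply walk_bent with (t := 1); auto; try lra.
    - intros w [<-|Hin]; [split; nra|].
      specialize (H1 w Hin). specialize (H2 w Hin). specialize (Hp w Hin). split; nra.
    - replace (Rabs (w1 - w2) + w2) with w1 by lra. lra.
    - simpl app. rewrite sum_sq_cons. lra. }
  simpl app in *. lra.
Qed.

(** * Three large terms *)

(* A quadratic minorant in [A], to be integrated using only the variance of [A].
   No single slope works: (1/3, 1/3, 1/3) forces it to be at most 2.52, (1/2, 1/2, 0) at least 2.88. *)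
Lemma three_signs_count c d e A :
  0 <= e <= d -> d <= c -> 1 < c + d + e -> 3 * c ^ 2 + d ^ 2 + e ^ 2 <= 1 ->
  344 / 100 + (if Rle_dec (/ 4) e then 24 / 10 else 3) * (1 - (c ^ 2 + d ^ 2 + e ^ 2) - A ^ 2) <=
  8 * mean [c; d; e] (fun y => good (A + y)).
Proof.
  intros H1 H2 H3 H4.
  (* From d <= c, (c + d)^2 <= 3 c^2 + d^2. It keeps A - c - d - e >= -1 once A > 1 - (c + d -
     e). *)
  assert (Hcd : c + d <= 1) by nra.
  assert (Hc : c <= 55 / 100).
  { pose proof (pow2_ge_0 (d - e)). assert ((1 - c) ^ 2 <= (d + e) ^ 2) by (apply pow_incr; lra). nra. }
  assert (Hq : / 3 <= c ^ 2 + d ^ 2 + e ^ 2) by nra.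
  (* With n of the eight sums in [-1, 1] and slope k, the claim reads c^2 + d^2 + e^2 + A^2 >= 1 -
     (n - 3.44)/k, where 3.44 is 8 times 0.43. [K1] to [K4] are n = 5, 4, 2, 1 for k = 2.4; [L2] to
     [L4] are n = 4, 2, 1 for k = 3. *)
  assert (K1 : / 4 <= e -> forall A, 0 <= A -> 1 - (c - d + e) <= A ->
    1 - 156 / 240 <= c ^ 2 + d ^ 2 + e ^ 2 + A ^ 2) by (intros; nra).
  assert (K2 : / 4 <= e -> forall A, 0 <= A -> 1 - (d + e - c) <= A ->
    1 - 56 / 240 <= c ^ 2 + d ^ 2 + e ^ 2 + A ^ 2) by (intros; clear K1; nra).
  assert (K3 : / 4 <= e -> forall A, 0 <= A -> 1 + (c - d + e) <= A ->
    1 + 144 / 240 <= c ^ 2 + d ^ 2 + e ^ 2 + A ^ 2) by (intros; clear K1 K2; nra).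
  assert (K4 : / 4 <= e -> forall A, 0 <= A -> 1 + (c + d - e) <= A ->
    1 + 244 / 240 <= c ^ 2 + d ^ 2 + e ^ 2 + A ^ 2) by (intros; clear K1 K2 K3; nra).
  assert (L2 : e <= / 4 -> forall A, 0 <= A -> 1 - (d + e - c) <= A ->
    1 - 56 / 300 <= c ^ 2 + d ^ 2 + e ^ 2 + A ^ 2) by (intros; clear K1 K2 K3 K4; nra).
  assert (L3 : e <= / 4 -> forall A, 0 <= A -> 1 + (c - d + e) <= A ->
    1 + 144 / 300 <= c ^ 2 + d ^ 2 + e ^ 2 + A ^ 2) by (intros; clear K1 K2 K3 K4 L2; nra).
  assert (L4 : e <= / 4 -> forall A, 0 <= A -> 1 + (c + d - e) <= A ->
    1 + 244 / 300 <= c ^ 2 + d ^ 2 + e ^ 2 + A ^ 2) by (intros; clear K1 K2 K3 K4 L2 L3; nra).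
  assert (H : forall A, 0 <= A ->
    344 / 100 + (if Rle_dec (/ 4) e then 24 / 10 else 3) * (1 - (c ^ 2 + d ^ 2 + e ^ 2) - A ^ 2) <=
    8 * mean [c; d; e] (fun y => good (A + y))).
  { clear A; intros A HA.
    rewrite !mean_good_cons; cbn [mean]; rewrite !Rplus_0_r.
    pose proof (good_bounds (A + c + d + e)). pose proof (good_bounds (A + c + d - e)).
    pose proof (good_bounds (A + c - d + e)). pose proof (good_bounds (A + c - d - e)).
    pose proof (good_bounds (A - c + d + e)). pose proof (good_bounds (A - c + d - e)).
    pose proof (good_bounds (A - c - d + e)). pose proof (good_bounds (A - c - d - e)).
    pose proof (pow2_ge_0 A).
    (* Apart from A = 1, the splits are at values of [A] where one of the eight sums passes 1. *)
    destruct (Rle_dec A 1) as [HA1|HA1].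
    - pose proof (good_in (A - c - d + e) ltac:(lra)).
      pose proof (good_in (A - c + d - e) ltac:(lra)).
      assert (1 <= good (A + c - d - e) + good (A - c + d + e)).
      { destruct (Rle_dec c (d + e)).
        - rewrite (good_in (A + c - d - e)); lra.
        - rewrite (good_in (A - c + d + e)); lra. }
      destruct (Rle_dec A (1 - (c + d - e))) as [HA2|HA2].
      { pose proof (good_in (A + c + d - e) ltac:(lra)).
        pose proof (good_in (A + c - d + e) ltac:(lra)).
        pose proof (good_in (A + c - d - e) ltac:(lra)).
        pose proof (good_in (A - c + d + e) ltac:(lra)).
        destruct (Rle_dec (/ 4) e); lra. }
      pose proof (good_in (A - c - d - e) ltac:(lra)).
      destruct (Rle_dec A (1 - (c - d + e))) as [HA3|HA3].
      { pose proof (good_in (A + c - d + e) ltac:(lra)).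
        pose proof (good_in (A + c - d - e) ltac:(lra)).
        pose proof (good_in (A - c + d + e) ltac:(lra)).
        destruct (Rle_dec (/ 4) e); lra. }
      assert (Hu : (1 - (c - d + e)) ^ 2 <= A ^ 2) by (apply pow_incr; lra).
      destruct (Rle_dec A (1 - (c - d - e))) as [HA4|HA4].
      (* Here A > 1 - c + d + e > 2 (1 - c) >= 0.9, by c <= 0.55. *)
      2: { assert ((9 / 10) ^ 2 <= A ^ 2) by (apply pow_incr; lra).
        destruct (Rle_dec (/ 4) e); lra. }
      destruct (Rle_dec A (1 - (d + e - c))) as [HA5|HA5].
      { pose proof (good_in (A - c + d + e) ltac:(lra)).
        pose proof (good_in (A + c - d - e) ltac:(lra)).
        destruct (Rle_dec (/ 4) e) as [He|He]; [specialize (K1 He A); lra|].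
        assert ((4 / 10) ^ 2 <= (1 - (c - d + e)) ^ 2) by (apply pow_incr; lra). lra. }
      destruct (Rle_dec (/ 4) e) as [He|He];
        [specialize (K2 He A)|specialize (L2 ltac:(lra) A)]; lra.
    - assert (1 <= A ^ 2) by nra.
      destruct (Rle_dec A (1 + (c - d + e))) as [HA2|HA2].
      { pose proof (good_in (A - c - d - e) ltac:(lra)).
        pose proof (good_in (A - c - d + e) ltac:(lra)).
        pose proof (good_in (A - c + d - e) ltac:(lra)).
        destruct (Rle_dec (/ 4) e); lra. }
      destruct (Rle_dec A (1 + (c + d - e))) as [HA3|HA3].
      { pose proof (good_in (A - c - d - e) ltac:(lra)).
        pose proof (good_in (A - c - d + e) ltac:(lra)).
        destruct (Rle_dec (/ 4) e) as [He|He];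
          [specialize (K3 He A)|specialize (L3 ltac:(lra) A)]; lra. }
      destruct (Rle_dec A (1 + (c + d + e))) as [HA4|HA4].
      { pose proof (good_in (A - c - d - e) ltac:(lra)).
        destruct (Rle_dec (/ 4) e) as [He|He];
          [specialize (K4 He A)|specialize (L4 ltac:(lra) A)]; lra. }
      assert (2 ^ 2 <= A ^ 2) by (apply pow_incr; lra).
      destruct (Rle_dec (/ 4) e); lra. }
  destruct (Rle_dec 0 A) as [H0|H0]; [auto|].
  rewrite <- mean_good_opp. replace (A ^ 2) with ((- A) ^ 2) by ring.
  apply H; lra.
Qed.

(** Integrating the minorant over [A]: E A^2 = [sum_sq l] is at most 1 - q, so the part with slope
    [k] contributes at least 0 and 344/800 = 43/100 remains. *)
Lemma three_big_case c d e l :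
  0 <= e <= d -> d <= c -> 1 < c + d + e -> 3 * c ^ 2 + d ^ 2 + e ^ 2 <= 1 ->
  sum_sq (c :: d :: e :: l) <= 1 ->
  43 / 100 <= mean (c :: d :: e :: l) good.
Proof.
  intros H1 H2 H3 H4 Hs. rewrite !sum_sq_cons in Hs.
  set (k := if Rle_dec (/ 4) e then 24 / 10 else 3).
  set (q := c ^ 2 + d ^ 2 + e ^ 2).
  assert (Hk : 0 <= k) by (unfold k; destruct (Rle_dec (/ 4) e); lra).
  assert (H : mean l (fun A => (344 / 100 + k * (1 - q)) / 8 * 1 + (- k / 8) * A ^ 2) <=
              mean l (fun A => mean [c; d; e] (fun y => good (A + y)))).
  { apply mean_le; intros A.
    pose proof (three_signs_count c d e A H1 H2 H3 H4). fold k q in H. lra. }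
  rewrite mean_lin, mean_const, mean_sq in H.
  assert (Hp : mean (c :: d :: e :: l) good = mean (l ++ [c; d; e]) good).
  { apply mean_perm. apply (Permutation_app_comm [c; d; e] l). }
  rewrite Hp. clear Hp.
  replace (mean (l ++ [c; d; e]) good) with
    (mean l (fun A => mean [c; d; e] (fun y => good (A + y)))).
  - assert (k * sum_sq l <= k * (1 - q)) by (apply Rmult_le_compat_l; unfold q; lra). lra.
  - apply mean_app.
Qed.

(** * Sorting and choice of the case *)

Lemma descending_exists l : exists l', Permutation l l' /\ descending l'.
Proof.
  assert (Hins : forall x l, descending l ->
    exists l', Permutation (x :: l) l' /\ descending l').
  { intros x; induction 1 as [|y l' Hl IH Hy].
    - exists [x]; split; [auto|]. constructor; [constructor|auto].
    - destruct (Rle_dec y x) as [Hyx|Hyx].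
      + exists (x :: y :: l'); split; [auto|].
        constructor; [constructor; auto|constructor; auto].
        eapply Forall_impl; [|exact Hy]. simpl; intros; lra.
      + destruct IH as (l2 & Hp & Hd). exists (y :: l2); split.
        * etransitivity; [apply perm_swap|]. auto.
        * constructor; auto. rewrite Forall_forall in *. intros z Hz.
          apply (Permutation_in z (Permutation_sym Hp)) in Hz.
          destruct Hz as [<-|Hz]; [lra|auto]. }
  induction l as [|x l (l' & Hp & Hd)].
  - exists []; split; [auto|constructor].
  - destruct (Hins x l' Hd) as (l2 & Hp2 & Hd2). exists l2; split; auto.
    etransitivity; [|exact Hp2]. auto.
Qed.

Lemma mean_zero_cons l f : mean (0 :: l) f = mean l f.
Proof.
  cbn [mean].
  rewrite (mean_ext l (fun y => f (0 + y)) f) by (intros; f_equal; lra).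
  rewrite (mean_ext l (fun y => f (- 0 + y)) f) by (intros; f_equal; lra). lra.
Qed.

Lemma mean_good_ge v : sum_sq v <= 1 -> 43 / 100 <= mean v good.
Proof.
  intros Hv.
  (* Five padding zeros change neither the law nor the variance, and guarantee the five entries that
     are named below. *)
  destruct (descending_exists ([0; 0; 0; 0; 0] ++ map Rabs v)) as (l & Hp & Hd).
  assert (Hm : mean v good = mean l good).
  { rewrite <- (mean_perm _ _ Hp). rewrite <- (mean_abs v good).
    simpl app. now rewrite !mean_zero_cons. }
  assert (Hs : sum_sq l <= 1).
  { rewrite <- (sum_sq_perm _ _ Hp). simpl app. rewrite !sum_sq_cons, sum_sq_abs. lra. }
  assert (H0 : Forall (Rle 0) l).
  { apply (Permutation_Forall Hp). simpl. repeat (constructor; [lra|]).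
    apply Forall_map, Forall_forall; intros; apply Rabs_pos. }
  apply Permutation_length in Hp. rewrite Hm; clear Hm.
  destruct l as [|a [|b [|c [|d [|e l]]]]]; simpl in Hp; try lia. clear Hp.
  inversion Hd as [|? ? Hd1 Ha]; subst. inversion Hd1 as [|? ? Hd2 Hb]; subst.
  inversion Hd2 as [|? ? Hd3 Hc]; subst. inversion Hd3 as [|? ? Hd4 He]; subst.
  pose proof H0 as Hpos. rewrite !Forall_cons_iff in *.
  (* The two largest terms go last, as the walk requires. *)
  assert (Hp : Permutation (a :: b :: c :: d :: e :: l) (c :: d :: e :: l ++ [a; b]))
    by (apply (Permutation_app_comm [a; b] (c :: d :: e :: l))).
  rewrite (mean_perm _ _ Hp), (sum_sq_perm _ _ Hp) in *.
  destruct (Rle_dec (c + d + e) 1) as [H|H].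
  - apply walk_case; auto; try tauto. rewrite !Forall_cons_iff; tauto.
  - assert (0 <= sum_sq l) by apply sum_sq_nonneg.
    apply three_big_case; try lra; try tauto.
    rewrite !sum_sq_cons, sum_sq_app in Hs. unfold sum_sq at 2 in Hs; simpl in Hs.
    assert (c ^ 2 <= a ^ 2) by (apply pow_incr; lra).
    assert (c ^ 2 <= b ^ 2) by (apply pow_incr; lra).
    lra.
Qed.

(** * Numerical bounds for the normal distribution *)

(** The term (-u)^n / n!, in a form that unfolds to plain arithmetic at a numeral [n]. *)
Fixpoint exp_neg_term (n : nat) (u : R) : R :=
  match n with
  | O => 1
  | S m => exp_neg_term m u * (- u / INR n)
  end.

Fixpoint exp_neg_taylor (n : nat) (u : R) : R :=
  match n with
  | O => 1
  | S m => exp_neg_taylor m u + exp_neg_term n u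
  end.

Lemma exp_neg_taylor_0 n : exp_neg_taylor n 0 = 1.
Proof.
  induction n as [|n IH]; cbn [exp_neg_taylor exp_neg_term]; [|rewrite IH]; unfold Rdiv; lra.
Qed.

Lemma exp_neg_term_derive n u :
  is_derive (exp_neg_term (S n)) u (- exp_neg_term n u).
Proof.
  induction n as [|n IH].
  - cbn. auto_derive; auto. field.
  - change (exp_neg_term (S (S n))) with
      (fun u => exp_neg_term (S n) u * (- u / INR (S (S n)))).
    pose proof (not_0_INR (S (S n)) ltac:(lia)) as H2.
    pose proof (not_0_INR (S n) ltac:(lia)) as H1.
    assert (Hl : forall r : R, is_derive (fun u => - u / r) u (- / r))
      by (intros r; auto_derive; auto; unfold Rdiv; ring).
    pose proof (is_derive_mult _ _ _ _ _ IH (Hl (INR (S (S n)))) Rmult_comm) as H.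
    replace (- exp_neg_term (S n) u) with
      (- exp_neg_term n u * (- u / INR (S (S n))) + exp_neg_term (S n) u * - / INR (S (S n))).
    + exact H.
    + cbn [exp_neg_term]. rewrite (S_INR (S n)) in *. field; auto.
Qed.

Lemma exp_neg_taylor_derive n u :
  is_derive (exp_neg_taylor (S n)) u (- exp_neg_taylor n u).
Proof.
  induction n as [|n IH].
  - cbn. auto_derive; auto. field.
  - change (exp_neg_taylor (S (S n))) with
      (fun u => exp_neg_taylor (S n) u + exp_neg_term (S (S n)) u).
    pose proof (is_derive_plus _ _ _ _ _ IH (exp_neg_term_derive (S n) u)) as H.
    unfold plus in H; simpl in H. cbn [exp_neg_taylor].
    rewrite Ropp_plus_distr. exact H.
Qed.

(** The signed remainder of order n + 1 vanishes at 0 and has the one of order n as derivative, so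
    nonnegativity passes up by the mean value theorem. *)
Lemma exp_neg_alternating n u : 0 <= u ->
  0 <= (-1) ^ n * (exp_neg_taylor n u - exp (- u)).
Proof.
  revert u; induction n as [|n IH]; intros u Hu.
  - cbn. enough (exp (- u) <= 1) by lra. rewrite <- exp_0.
    destruct (Req_dec u 0) as [->|]; [rewrite Ropp_0; lra|].
    left; apply exp_increasing; lra.
  - destruct (MVT_gen (fun u => (-1) ^ S n * (exp_neg_taylor (S n) u - exp (- u))) 0 u
      (fun u => (-1) ^ n * (exp_neg_taylor n u - exp (- u)))) as (c & Hc & Heq).
    + intros x _. 
      assert (He : is_derive (fun u => exp (- u)) x (- exp (- x)))
        by (auto_derive; auto; ring).
      pose proof (is_derive_scal _ x ((-1) ^ S n) _
        (is_derive_minus _ _ _ _ _ (exp_neg_taylor_derive n x) He)) as H.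
      unfold minus, plus, opp, scal in H; simpl in H; unfold mult in H; simpl in H.
      replace ((-1) ^ n * (exp_neg_taylor n x - exp (- x))) with
        (-1 * (-1) ^ n * (- exp_neg_taylor n x + - - exp (- x))) by ring.
      exact H.
    + intros x _.
      apply continuity_pt_filterlim. 
      apply (ex_derive_continuous (fun u => (-1) ^ S n * (exp_neg_taylor (S n) u - exp (- u)))).
      assert (ex_derive (exp_neg_taylor (S n)) x) by (eexists; apply exp_neg_taylor_derive).
      auto_derive; auto.
    + rewrite Rmin_left, Rmax_right in Hc by lra.
      rewrite exp_neg_taylor_0, Ropp_0, exp_0 in Heq.
      pose proof (IH c ltac:(lra)).
      assert (0 <= (-1) ^ n * (exp_neg_taylor n c - exp (- c)) * (u - 0))
        by (apply Rmult_le_pos; lra).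
      lra.
Qed.

(** Termwise integral of the Taylor sum at u = t^2/2; the even order 8 overestimates, as the odd
    order 5 underestimates in [RInt_gauss_lower]. *)
Lemma RInt_gauss_upper b : 0 <= b ->
  RInt gauss 0 b <= b - b^3/6 + b^5/40 - b^7/336 + b^9/3456 - b^11/42240 + b^13/599040
    - b^15/9676800 + b^17/175472640.
Proof.
  intros Hb.
  set (F t := t - t^3/6 + t^5/40 - t^7/336 + t^9/3456 - t^11/42240 + t^13/599040
    - t^15/9676800 + t^17/175472640).
  set (f t := 1 - t^2/2 + t^4/8 - t^6/48 + t^8/384 - t^10/3840 + t^12/46080
    - t^14/645120 + t^16/10321920).
  apply (is_RInt_le gauss f 0 b _ (F b)); auto.
  - apply (RInt_correct gauss), ex_RInt_Reals_1, gauss_int.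
  - replace (F b) with (F b - F 0) by (unfold F; field).
    apply (is_RInt_derive F f); intros x _.
    + unfold F, f; auto_derive; auto; field.
    + apply (ex_derive_continuous f); unfold f; auto_derive; auto.
  - intros t _. unfold f, gauss.
    assert (H : 0 <= t ^ 2 / 2) by (pose proof (pow2_ge_0 t); lra).
    apply (exp_neg_alternating 8) in H.
    cbn [exp_neg_taylor exp_neg_term INR] in H.
    replace (- t ^ 2 / 2) with (- (t ^ 2 / 2)) by field. lra.
Qed.

Lemma RInt_gauss_lower b : 0 <= b ->
  b - b^3/6 + b^5/40 - b^7/336 + b^9/3456 - b^11/42240 <= RInt gauss 0 b.
Proof.
  intros Hb.
  set (F t := t - t^3/6 + t^5/40 - t^7/336 + t^9/3456 - t^11/42240).
  set (f t := 1 - t^2/2 + t^4/8 - t^6/48 + t^8/384 - t^10/3840).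
  apply (is_RInt_le f gauss 0 b (F b)); auto.
  - replace (F b) with (F b - F 0) by (unfold F; field).
    apply (is_RInt_derive F f); intros x _.
    + unfold F, f; auto_derive; auto; field.
    + apply (ex_derive_continuous f); unfold f; auto_derive; auto.
  - apply (RInt_correct gauss), ex_RInt_Reals_1, gauss_int.
  - intros t _. unfold f, gauss.
    assert (H : 0 <= t ^ 2 / 2) by (pose proof (pow2_ge_0 t); lra).
    apply (exp_neg_alternating 5) in H.
    cbn [exp_neg_taylor exp_neg_term INR] in H.
    replace (- t ^ 2 / 2) with (- (t ^ 2 / 2)) by field. lra.
Qed.

Lemma PI_lower : 3136 / 1000 <= PI.
Proof.
  (* Four terms of the alternating series from PI/4 = 2 atan(1/3) + atan(1/7). *)
  pose proof (proj1 (PI_2_3_7_ineq 1)) as H.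
  unfold tg_alt, PI_2_3_7_tg, Ratan_seq in H; simpl in H. lra.
Qed.

Lemma inv_sqrt_2PI_bounds : 0 < / sqrt (2 * PI) <= 1000 / 2504.
Proof.
  pose proof PI_lower.
  assert (2504 / 1000 <= sqrt (2 * PI)).
  { rewrite <- (sqrt_pow2 (2504 / 1000)) by lra. apply sqrt_le_1_alt; lra. }
  split; [apply Rinv_0_lt_compat; lra|].
  replace (1000 / 2504) with (/ (2504 / 1000)) by field. apply Rinv_le_contravar; lra.
Qed.

Lemma G_quarter_le : G (/ 4) <= 43 / 100.
Proof.
  unfold G, Phi.
  replace (/ sqrt (/ 4)) with 2.
  2: { replace (/ 4) with ((/ 2) ^ 2) by field. rewrite sqrt_pow2 by lra. field. }
  rewrite <- !RInt_Reals.
  set (k := / sqrt (2 * PI)). assert (Hk : 0 < k <= 1000 / 2504) by apply inv_sqrt_2PI_bounds.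
  pose proof (RInt_gauss_upper 2 ltac:(lra)) as H2.
  set (r := sqrt 2).
  assert (Hr2 : r ^ 2 = 2) by (unfold r; rewrite pow2_sqrt; lra).
  assert (Hr : 1414 / 1000 <= r <= 1415 / 1000).
  { assert (0 <= r) by apply sqrt_pos. split; nra. }
  (* Odd powers of [r] become multiples of [r], which makes the series bounds linear. *)
  assert (Hpow : forall n, r ^ (2 * n + 1) = 2 ^ n * r).
  { intros n. rewrite pow_add, pow_mult, Hr2. ring. }
  pose proof (RInt_gauss_upper r ltac:(lra)) as Hu.
  pose proof (RInt_gauss_lower r ltac:(lra)) as Hl.
  rewrite (Hpow 1%nat : r ^ 3 = _), (Hpow 2%nat : r ^ 5 = _), (Hpow 3%nat : r ^ 7 = _), (Hpow 4%nat : r ^ 9 = _), (Hpow 5%nat : r ^ 11 = _) in Hl.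
  rewrite (Hpow 1%nat : r ^ 3 = _), (Hpow 2%nat : r ^ 5 = _), (Hpow 3%nat : r ^ 7 = _), (Hpow 4%nat : r ^ 9 = _), (Hpow 5%nat : r ^ 11 = _),
    (Hpow 6%nat : r ^ 13 = _), (Hpow 7%nat : r ^ 15 = _), (Hpow 8%nat : r ^ 17 = _) in Hu.
  set (I2 := RInt gauss 0 2) in *. set (Ir := RInt gauss 0 r) in *.
  assert (Hr1 : 1055 / 1000 <= Ir <= 11 / 10) by lra.
  assert (HI2 : I2 <= 11965 / 10000) by lra.
  assert (HD : 0 < 1 - (/ 2 + k * Ir)) by nra.
  (* A ratio of 0.28 gives 1/2 - 0.28/4 = 0.43. Cleared of the denominator, it asks for k (I2 - 0.28
     Ir) <= 0.36, and 0.9011/2.504 is just below that. *)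
  assert (28 / 100 <= (1 - (/ 2 + k * I2)) / (1 - (/ 2 + k * Ir))); [|lra].
  apply Rmult_le_reg_r with (1 - (/ 2 + k * Ir)); auto.
  unfold Rdiv at 2; rewrite Rmult_assoc, Rinv_l, Rmult_1_r by lra. nra.
Qed.

Theorem theorem1 (v : list R) (hn : (1 <= length v)%nat) (hv : sum_sq v <= 1) :
  prob_abs_S_le_1 v >= G (/ 4).
Proof.
  rewrite prob_mean. apply Rle_ge.
  apply Rle_trans with (43 / 100); [apply G_quarter_le|apply mean_good_ge; auto].
Qed.
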